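(* For two robots, given any two states $(X,Y,\sigma)$ and $(X',Y',\sigma')$, the minimum makespan of a feasible schedule from some configuration in state $(X,Y,\sigma)$ to some configuration in state $(X',Y',\sigma')$ (Min-Makespan CMP between the two states) can be computed in $\mathcal{O}(1)$ time.
   Context: Robots are axis-parallel unit squares: a robot at position $p$ occupies $p+\boxdot$, $\boxdot=\{q:\|q\|_\infty\le1/2\}$. Distances use the $L_1$ norm. A configuration of two robots is a pair $(p_1,p_2)$ with $\|p_1-p_2\|_\infty\ge 1$; $\mathcal{F}_2$ is the set of these. A trajectory over $T=[t_0,t_1]$ is a $1$-Lipschitz (w.r.t. $L_1$) map $m:T\to\mathbb{R}^2$ with polygonal-chain image; a schedule $M=(m_1,m_2)$ is feasible if $M(t)\in\mathcal{F}_2$ for all $t$; its makespan is $t_1-t_0$. A horizontal trapezoid is a trapezoid with two horizontal parallel sides. A state is a triple $(X,Y,\sigma)$ where $X,Y$ are horizontal trapezoids that are either interior disjoint or equal, and $\sigma\in\{-2,-1,0,1,2\}$. A configuration $(p_1,p_2)\in\mathcal{F}_2$ is in state $(X,Y,\sigma)$ if $p_1\in X$, $p_2\in Y$, and: if $\sigma=0$ there is no further restriction; if $\sigma=1$ then $x(p_1)\le x(p_2)+1$; if $\sigma=-1$ then $x(p_1)\ge x(p_2)-1$; if $\sigma=2$ then $y(p_1)\le y(p_2)+1$; if $\sigma=-2$ then $y(p_1)\ge y(p_2)-1$. *)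

(* Defs.v *)
From Stdlib Require Import Reals ZArith List.
Import ListNotations.
Open Scope R_scope.

Definition pt : Type := (R * R)%type.

Definition l1 (p q : pt) : R := Rabs (fst p - fst q) + Rabs (snd p - snd q).
Definition linf (p q : pt) : R := Rmax (Rabs (fst p - fst q)) (Rabs (snd p - snd q)).

(** A horizontal trapezoid: bottom side at height [ty0] from x=[ta0] to x=[tb0],
    top side at height [ty1] from x=[ta1] to x=[tb1]. *)
Record htrap : Type := Htrap {
  ty0 : R; ty1 : R; ta0 : R; tb0 : R; ta1 : R; tb1 : R }.

(** Well-formedness: a genuine (closed, positive-area) trapezoid with two
    horizontal parallel sides (one of them may degenerate to a point:
    triangles are allowed). *)
Definition htrap_wf (T : htrap) : Prop :=
  ty0 T < ty1 T /\ ta0 T <= tb0 T /\ ta1 T <= tb1 T /\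
  (ta0 T < tb0 T \/ ta1 T < tb1 T).

Definition in_htrap (T : htrap) (p : pt) : Prop :=
  let y := snd p in let x := fst p in
  let lam := (y - ty0 T) / (ty1 T - ty0 T) in
  ty0 T <= y <= ty1 T /\
  ta0 T + lam * (ta1 T - ta0 T) <= x <= tb0 T + lam * (tb1 T - tb0 T).

Definition interior (S : pt -> Prop) (p : pt) : Prop :=
  exists eps, 0 < eps /\ forall q, l1 p q < eps -> S q.

Definition interior_disjoint (S S' : pt -> Prop) : Prop :=
  forall p, ~ (interior S p /\ interior S' p).

Definition same_set (S S' : pt -> Prop) : Prop := forall p, S p <-> S' p.

Definition in_F2 (p1 p2 : pt) : Prop := 1 <= linf p1 p2.

Definition valid_state (X Y : htrap) (s : Z) : Prop :=
  htrap_wf X /\ htrap_wf Y /\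
  (interior_disjoint (in_htrap X) (in_htrap Y) \/ same_set (in_htrap X) (in_htrap Y)) /\
  (-2 <= s <= 2)%Z.

Definition sigma_cond (s : Z) (p1 p2 : pt) : Prop :=
  (s = 1%Z -> fst p1 <= fst p2 + 1) /\
  (s = (-1)%Z -> fst p1 >= fst p2 - 1) /\
  (s = 2%Z -> snd p1 <= snd p2 + 1) /\
  (s = (-2)%Z -> snd p1 >= snd p2 - 1).

Definition in_state (X Y : htrap) (s : Z) (p1 p2 : pt) : Prop :=
  in_F2 p1 p2 /\ in_htrap X p1 /\ in_htrap Y p2 /\ sigma_cond s p1 p2.

Definition on_seg (p p' q : pt) : Prop :=
  exists s, 0 <= s <= 1 /\
    q = (fst p + s * (fst p' - fst p), snd p + s * (snd p' - snd p)).

Fixpoint on_chain (l : list pt) (q : pt) : Prop :=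
  match l with
  | nil => False
  | p :: r =>
      match r with
      | nil => q = p
      | p' :: _ => on_seg p p' q \/ on_chain r q
      end
  end.

Definition trajectory (t0 t1 : R) (m : R -> pt) : Prop :=
  t0 <= t1 /\
  (forall s t, t0 <= s <= t1 -> t0 <= t <= t1 -> l1 (m s) (m t) <= Rabs (s - t)) /\
  exists l : list pt, l <> nil /\
    forall q, (exists t, t0 <= t <= t1 /\ m t = q) <-> on_chain l q.

Definition feasible_schedule (t0 t1 : R) (m1 m2 : R -> pt) : Prop :=
  trajectory t0 t1 m1 /\ trajectory t0 t1 m2 /\
  forall t, t0 <= t <= t1 -> in_F2 (m1 t) (m2 t).

Definition schedule_between (X Y : htrap) (s : Z) (X' Y' : htrap) (s' : Z)
    (t0 t1 : R) (m1 m2 : R -> pt) : Prop :=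
  feasible_schedule t0 t1 m1 m2 /\
  in_state X Y s (m1 t0) (m2 t0) /\ in_state X' Y' s' (m1 t1) (m2 t1).

Definition min_makespan_answer (X Y : htrap) (s : Z) (X' Y' : htrap) (s' : Z)
    (v : option R) : Prop :=
  match v with
  | None => forall t0 t1 m1 m2, ~ schedule_between X Y s X' Y' s' t0 t1 m1 m2
  | Some v =>
      (exists t0 t1 m1 m2, schedule_between X Y s X' Y' s' t0 t1 m1 m2 /\ t1 - t0 = v) /\
      (forall t0 t1 m1 m2, schedule_between X Y s X' Y' s' t0 t1 m1 m2 -> v <= t1 - t0)
  end.

(** Real-RAM algorithms on a fixed number of real inputs: algebraic
    computation trees (arithmetic +,-,*,/ with integer constants, branching on
    the sign of computed values). A finite tree runs in O(1) time on inputs of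
    constant size. Division by zero evaluates to 0 (irrelevant, as the tree
    may test for it). *)
Inductive aexpr : Type :=
  | AInp : nat -> aexpr
  | ACst : Z -> aexpr
  | AAdd : aexpr -> aexpr -> aexpr
  | ASub : aexpr -> aexpr -> aexpr
  | AMul : aexpr -> aexpr -> aexpr
  | ADiv : aexpr -> aexpr -> aexpr.

Fixpoint aeval (inp : list R) (e : aexpr) : R :=
  match e with
  | AInp i => nth i inp 0
  | ACst z => IZR z
  | AAdd a b => aeval inp a + aeval inp b
  | ASub a b => aeval inp a - aeval inp b
  | AMul a b => aeval inp a * aeval inp b
  | ADiv a b => let d := aeval inp b in
                if Req_EM_T d 0 then 0 else aeval inp a / d
  end.

Inductive ctree : Type :=
  | CLeaf : option aexpr -> ctree
  (* [CBranch e tneg tzero tpos] branches on the sign of [e]. *)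
  | CBranch : aexpr -> ctree -> ctree -> ctree -> ctree.

Fixpoint ceval (inp : list R) (t : ctree) : option R :=
  match t with
  | CLeaf None => None
  | CLeaf (Some e) => Some (aeval inp e)
  | CBranch e tn tz tp =>
      let v := aeval inp e in
      match Rlt_dec v 0 with
      | left _ => ceval inp tn
      | right _ => if Req_EM_T v 0 then ceval inp tz else ceval inp tp
      end
  end.

Definition enc_htrap (T : htrap) : list R :=
  [ty0 T; ty1 T; ta0 T; tb0 T; ta1 T; tb1 T].

Definition enc_states (X Y : htrap) (s : Z) (X' Y' : htrap) (s' : Z) : list R :=
  enc_htrap X ++ enc_htrap Y ++ [IZR s] ++ enc_htrap X' ++ enc_htrap Y' ++ [IZR s'].

(* Main.v *)
(** The relative position of two non-overlapping robots lies in one of four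
    closed half-planes: robot 2 is to the east, west, north or south of robot 1
    by at least 1.  Given a feasible schedule, move straight from the initial
    configuration to the last one lying in a half-plane containing it: by
    convexity this is feasible, it is not slower, and that half-plane is never
    visited again.  So some optimal schedule consists of at most four straight
    legs, each inside one half-plane.  For a fixed sequence of half-planes, the
    start and end states, the break points and the break times are the solutions
    of a system of non-strict linear inequalities whose coefficients are
    polynomials in the input.  Fourier-Motzkin elimination, branching on the
    signs of the coefficients, turns the minimisation of the makespan into a
    finite computation tree, and finitely many sequences of half-planes remain
    to be compared. *)

Require Import Defs.
From Stdlib Require Import Reals ZArith List Lra Lia Classical.
Import ListNotations.
Open Scope R_scope.

(** * Computing minima of parametrised sets of reals *)

Definition computes_min (T : ctree) (P : list R -> R -> Prop) : Prop :=
  forall inp,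
    match ceval inp T with
    | None => forall v, ~ P inp v
    | Some v => P inp v /\ forall w, P inp w -> v <= w
    end.

(** One tree has to serve every parameter list: it is chosen before [inp]. This uniformity is what
    constant time amounts to. *)
Definition min_computable (P : list R -> R -> Prop) : Prop :=
  exists T, computes_min T P.

(** The continuation receives the expression at the leaf, not its value, so that later branches can
    compute with it. *)
Fixpoint graft (T : ctree) (k : option aexpr -> ctree) : ctree :=
  match T with
  | CLeaf o => k o
  | CBranch e tn tz tp => CBranch e (graft tn k) (graft tz k) (graft tp k)
  end.

(** The leaf that is reached depends on [inp] alone. Hence [o] comes before [k], and the same [o]
    describes both the result of [T] and every continuation of it. *)
Lemma ceval_graft inp T :
  exists o, ceval inp T = option_map (aeval inp) o /\
    forall k, ceval inp (graft T k) = ceval inp (k o).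
Proof.
  induction T as [o | e tn IHn tz IHz tp IHp]; simpl.
  - exists o; split; [destruct o|]; reflexivity.
  - destruct (Rlt_dec (aeval inp e) 0); [exact IHn|].
    destruct (Req_EM_T (aeval inp e) 0); [exact IHz | exact IHp].
Qed.

Lemma min_computable_False : min_computable (fun _ _ => False).
Proof. exists (CLeaf None); intros inp; simpl; tauto. Qed.

Lemma min_computable_or P Q :
  min_computable P -> min_computable Q ->
  min_computable (fun inp v => P inp v \/ Q inp v).
Proof.
  intros [T HT] [U HU].
  exists (graft T (fun a => graft U (fun b =>
    match a, b with
    | None, _ => CLeaf b
    | _, None => CLeaf a
    | Some x, Some y => CBranch (ASub x y) (CLeaf a) (CLeaf a) (CLeaf b)
    end))).
  intros inp; specialize (HT inp); specialize (HU inp).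
  destruct (ceval_graft inp T) as [a [Ea Ka]].
  destruct (ceval_graft inp U) as [b [Eb Kb]].
  rewrite Ka, Kb; rewrite Ea in HT; rewrite Eb in HU.
  destruct a as [x|], b as [y|]; simpl in *.
  - destruct HT as [HT1 HT2], HU as [HU1 HU2].
    destruct (Rlt_dec (aeval inp x - aeval inp y) 0);
      [|destruct (Req_EM_T (aeval inp x - aeval inp y) 0)]; simpl;
      (split; [tauto|]); intros w [Hw|Hw];
      try apply HT2 in Hw; try apply HU2 in Hw; lra.
  - split; [tauto|]. intros w [Hw|Hw]; [apply HT; exact Hw|destruct (HU w Hw)].
  - split; [tauto|]. intros w [Hw|Hw]; [destruct (HT w Hw)|apply HU; exact Hw].
  - intros v [Hv|Hv]; [exact (HT v Hv)|exact (HU v Hv)].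
Qed.

Lemma min_computable_ex_In (A : Type) (l : list A) (P : A -> list R -> R -> Prop) :
  (forall x, min_computable (P x)) ->
  min_computable (fun inp v => exists x, In x l /\ P x inp v).
Proof.
  intros HP; induction l as [|x l [T HT]].
  - destruct min_computable_False as [T HT]; exists T; intros inp.
    specialize (HT inp); destruct (ceval inp T); simpl in *; firstorder.
  - destruct (min_computable_or _ _ (HP x) (ex_intro _ T HT)) as [U HU].
    exists U; intros inp; specialize (HU inp); simpl.
    assert (E : forall w, (exists y, (x = y \/ In y l) /\ P y inp w) <->
              (P x inp w \/ exists y, In y l /\ P y inp w)).
    { intros w; split.
      - intros [y [[->|Hy] Hw]]; eauto.
      - intros [Hw|[y [Hy Hw]]]; eauto. }
    destruct (ceval inp U).
    + destruct HU as [HU1 HU2]; split; [apply E; exact HU1|].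
      intros w Hw; apply HU2, E, Hw.
    + intros v Hv; apply (HU v), E, Hv.
Qed.

(** * Parametric linear programming *)

(** Terms affine in the variables, with coefficients that are expressions in the input. Elimination
    can thus be carried out symbolically, and a tree can branch on the sign of a coefficient. *)
Inductive lin : Type :=
  | LVar : nat -> lin
  | LCst : aexpr -> lin
  | LAdd : lin -> lin -> lin
  | LScale : aexpr -> lin -> lin.

Fixpoint lval (inp : list R) (env : nat -> R) (t : lin) : R :=
  match t with
  | LVar i => env i
  | LCst a => aeval inp a
  | LAdd t u => lval inp env t + lval inp env u
  | LScale a t => aeval inp a * lval inp env t
  end.

Fixpoint coef (i : nat) (t : lin) : aexpr :=
  match t with
  | LVar j => if Nat.eqb i j then ACst 1 else ACst 0
  | LCst _ => ACst 0
  | LAdd t u => AAdd (coef i t) (coef i u)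
  | LScale a t => AMul a (coef i t)
  end.

Fixpoint remove_var (i : nat) (t : lin) : lin :=
  match t with
  | LVar j => if Nat.eqb i j then LCst (ACst 0) else LVar j
  | LCst a => LCst a
  | LAdd t u => LAdd (remove_var i t) (remove_var i u)
  | LScale a t => LScale a (remove_var i t)
  end.

Fixpoint constant_term (t : lin) : aexpr :=
  match t with
  | LVar _ => ACst 0
  | LCst a => a
  | LAdd t u => AAdd (constant_term t) (constant_term u)
  | LScale a t => AMul a (constant_term t)
  end.

Fixpoint width (t : lin) : nat :=
  match t with
  | LVar i => S i
  | LCst _ => 0
  | LAdd t u => Nat.max (width t) (width u)
  | LScale _ t => width t
  end.

Lemma lval_remove_var inp env i t :
  lval inp env t = aeval inp (coef i t) * env i + lval inp env (remove_var i t).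
Proof.
  induction t as [j|a|t IHt u IHu|a t IHt]; simpl.
  - destruct (Nat.eqb_spec i j) as [->|]; simpl; ring.
  - ring.
  - rewrite IHt, IHu; ring.
  - rewrite IHt; ring.
Qed.

Lemma lval_ext inp env env' t :
  (forall i, (i < width t)%nat -> env i = env' i) -> lval inp env t = lval inp env' t.
Proof.
  induction t as [j|a|t IHt u IHu|a t IHt]; simpl; intros H.
  - apply H; lia.
  - reflexivity.
  - rewrite IHt, IHu; [reflexivity| |]; intros i Hi; apply H; lia.
  - rewrite IHt; [reflexivity|exact H].
Qed.

Lemma lval_width1 inp env t :
  (width t <= 1)%nat ->
  lval inp env t = aeval inp (coef 0 t) * env 0%nat + aeval inp (constant_term t).
Proof.
  induction t as [j|a|t IHt u IHu|a t IHt]; simpl; intros H.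
  - destruct j; [simpl; ring|lia].
  - ring.
  - rewrite IHt, IHu by lia; ring.
  - rewrite IHt by lia; ring.
Qed.

Lemma width_remove_var n t : (width t <= S n)%nat -> (width (remove_var n t) <= n)%nat.
Proof.
  induction t as [j|a|t IHt u IHu|a t IHt]; simpl; intros H; try lia.
  destruct (Nat.eqb_spec n j); simpl; lia.
Qed.

(** * Fourier-Motzkin elimination of one variable *)

Definition sat (inp : list R) (env : nat -> R) (cs : list lin) : Prop :=
  forall t, In t cs -> 0 <= lval inp env t.

(** The partition by sign depends on the input, so it is found by branching: each path of the tree
    hands its own three lists to [k]. *)
Fixpoint by_sign (i : nat) (cs : list lin)
    (k : list lin -> list lin -> list lin -> ctree) : ctree :=
  match cs with
  | nil => k nil nil nil
  | t :: cs =>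
      CBranch (coef i t)
        (by_sign i cs (fun P N Z => k P (t :: N) Z))
        (by_sign i cs (fun P N Z => k P N (t :: Z)))
        (by_sign i cs (fun P N Z => k (t :: P) N Z))
  end.

Lemma by_sign_spec inp i cs : forall k,
  exists P N Z, ceval inp (by_sign i cs k) = ceval inp (k P N Z) /\
    (forall t, In t P <-> In t cs /\ 0 < aeval inp (coef i t)) /\
    (forall t, In t N <-> In t cs /\ aeval inp (coef i t) < 0) /\
    (forall t, In t Z <-> In t cs /\ aeval inp (coef i t) = 0).
Proof.
  induction cs as [|t cs IH]; intros k; simpl.
  - exists nil, nil, nil; simpl; repeat split; tauto.
  - destruct (Rlt_dec (aeval inp (coef i t)) 0) as [Hn|Hn];
      [|destruct (Req_EM_T (aeval inp (coef i t)) 0) as [Hz|Hz]].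
    + destruct (IH (fun P N Z => k P (t :: N) Z)) as (P & N & Z & E & HP & HN & HZ).
      exists P, (t :: N), Z; split; [exact E|].
      split; [|split]; intros u; simpl; rewrite ?HP, ?HN, ?HZ; intuition (subst; lra).
    + destruct (IH (fun P N Z => k P N (t :: Z))) as (P & N & Z & E & HP & HN & HZ).
      exists P, N, (t :: Z); split; [exact E|].
      split; [|split]; intros u; simpl; rewrite ?HP, ?HN, ?HZ; intuition (subst; lra).
    + destruct (IH (fun P N Z => k (t :: P) N Z)) as (P & N & Z & E & HP & HN & HZ).
      exists (t :: P), N, Z; split; [exact E|].
      split; [|split]; intros u; simpl; rewrite ?HP, ?HN, ?HZ; intuition (subst; lra).
Qed.

(** The combination of [t] and [u] in which variable [i] cancels. Both weights are positive when
    [coef i t > 0 > coef i u], and no division occurs. *)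
Definition resolvent (i : nat) (t u : lin) : lin :=
  LAdd (LScale (coef i t) (remove_var i u))
       (LScale (ASub (ACst 0) (coef i u)) (remove_var i t)).

Definition eliminate (i : nat) (P N Z : list lin) : list lin :=
  map (remove_var i) Z ++ flat_map (fun t => map (resolvent i t) N) P.

Lemma In_eliminate i P N Z t :
  In t (eliminate i P N Z) <->
  (exists u, In u Z /\ t = remove_var i u) \/
  (exists u w, In u P /\ In w N /\ t = resolvent i u w).
Proof.
  unfold eliminate; rewrite in_app_iff, in_map_iff, in_flat_map; split.
  - intros [[u [E Hu]]|[u [Hu Ht]]]; [left; eauto|right].
    apply in_map_iff in Ht; destruct Ht as [w [E Hw]]; eauto 6.
  - intros [[u [Hu E]]|[u [w [Hu [Hw E]]]]]; [left; eauto|right].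
    exists u; split; [exact Hu|]; apply in_map_iff; eauto.
Qed.

Lemma list_has_max (A : Type) (f : A -> R) (l : list A) :
  l = nil \/ exists x, In x l /\ forall y, In y l -> f y <= f x.
Proof.
  induction l as [|a l [->|[x [Hx Hm]]]]; [left; reflexivity| |]; right.
  - exists a; split; [left; reflexivity|]; intros y [->|[]]; lra.
  - destruct (Rle_dec (f x) (f a)).
    + exists a; split; [left; reflexivity|]; intros y [->|Hy]; [lra|].
      specialize (Hm y Hy); lra.
    + exists x; split; [right; exact Hx|]; intros y [->|Hy]; [lra|exact (Hm y Hy)].
Qed.

(** The largest lower bound serves as [c]; without lower bounds the smallest upper bound does, and 0
    if both lists are empty. *)
Lemma list_separation (A : Type) (f g : A -> R) (l u : list A) :
  (forall x y, In x l -> In y u -> f x <= g y) ->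
  exists c, (forall x, In x l -> f x <= c) /\ (forall y, In y u -> c <= g y).
Proof.
  intros H.
  destruct (list_has_max A f l) as [->|[x [Hx Hm]]].
  - destruct (list_has_max A (fun y => - g y) u) as [->|[y [Hy Hm]]].
    + exists 0; simpl; tauto.
    + exists (g y); simpl; split; [tauto|]; intros z Hz; specialize (Hm z Hz); lra.
  - exists (f x); auto.
Qed.

(** Forward, a resolvent is a positive combination of two satisfied constraints. Backward, the
    resolvents place every lower bound on variable [i] below every upper bound, so a value in
    between exists. As [i <> 0], resetting variable [i] leaves the objective, variable 0,
    unchanged. *)
Lemma eliminate_spec inp i cs P N Z v :
  (forall t, In t P <-> In t cs /\ 0 < aeval inp (coef i t)) ->
  (forall t, In t N <-> In t cs /\ aeval inp (coef i t) < 0) ->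
  (forall t, In t Z <-> In t cs /\ aeval inp (coef i t) = 0) ->
  (forall t, In t cs -> (width t <= S i)%nat) -> i <> 0%nat ->
  (exists env, env 0%nat = v /\ sat inp env cs) <->
  (exists env, env 0%nat = v /\ sat inp env (eliminate i P N Z)).
Proof.
  intros HP HN HZ HW Hi; split; intros [env [Hv Hs]].
  - exists env; split; [exact Hv|]; intros t Ht.
    apply In_eliminate in Ht; destruct Ht as [[u [Hu ->]]|[u [w [Hu [Hw ->]]]]].
    + apply HZ in Hu; destruct Hu as [Hu E]; specialize (Hs u Hu).
      rewrite (lval_remove_var inp env i u), E in Hs; lra.
    + apply HP in Hu; apply HN in Hw; destruct Hu as [Hu Eu], Hw as [Hw Ew].
      assert (Su := Hs u Hu); assert (Sw := Hs w Hw).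
      rewrite (lval_remove_var inp env i) in Su, Sw; simpl.
      set (a := aeval inp (coef i u)) in *; set (b := aeval inp (coef i w)) in *.
      set (x := env i) in *.
      set (r := lval inp env (remove_var i u)) in *.
      set (s := lval inp env (remove_var i w)) in *.
      replace (a * s + (0 - b) * r) with (a * (b * x + s) + (- b) * (a * x + r)) by ring.
      apply Rplus_le_le_0_compat; apply Rmult_le_pos; lra.
  - set (a := fun t => aeval inp (coef i t)) in *.
    set (r := fun t => lval inp env (remove_var i t)).
    destruct (list_separation lin (fun t => - r t / a t) (fun t => r t / - a t) P N)
      as [x [HxP HxN]].
    { intros u w Hu Hw.
      assert (Hr : 0 <= a u * r w + (0 - a w) * r u).
      { apply (Hs (resolvent i u w)), In_eliminate; eauto 7. }
      apply HP in Hu; apply HN in Hw; destruct Hu as [_ Eu], Hw as [_ Ew].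
      fold (a u) in Eu; fold (a w) in Ew.
      apply Rmult_le_reg_l with (a u * - a w); [apply Rmult_lt_0_compat; lra|].
      replace (a u * - a w * (- r u / a u)) with (a w * r u) by (field; lra).
      replace (a u * - a w * (r w / - a w)) with (a u * r w) by (field; lra).
      lra. }
    exists (fun j => if Nat.eqb i j then x else env j); split.
    { destruct (Nat.eqb_spec i 0); [contradiction|exact Hv]. }
    intros t Ht; rewrite (lval_remove_var _ _ i), Nat.eqb_refl.
    (* By the width bound [i] is the highest index, so the remainder only has smaller ones and does
       not see the new value. *)
    rewrite (lval_ext inp _ env (remove_var i t)).
    2: { intros j Hj; assert (Hw := width_remove_var i t (HW t Ht)).
         destruct (Nat.eqb_spec i j); [lia|reflexivity]. }
    fold (a t) (r t).
    destruct (Rtotal_order (a t) 0) as [Ha|[Ha|Ha]].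
    + specialize (HxN t (proj2 (HN t) (conj Ht Ha))); simpl in HxN.
      apply Rmult_le_compat_l with (r := - a t) in HxN; [|lra].
      replace (- a t * (r t / - a t)) with (r t) in HxN by (field; lra); lra.
    + rewrite Ha, Rmult_0_l, Rplus_0_l.
      apply Hs, In_eliminate; left; exists t; split; [apply HZ; auto|reflexivity].
    + specialize (HxP t (proj2 (HP t) (conj Ht Ha))); simpl in HxP.
      apply Rmult_le_compat_l with (r := a t) in HxP; [|lra].
      replace (a t * (- r t / a t)) with (- r t) in HxP by (field; lra); lra.
Qed.

(** * Minimising the last remaining variable *)

Definition lower_bound (t : lin) : aexpr :=
  ADiv (ASub (ACst 0) (constant_term t)) (coef 0 t).

Fixpoint max_lower_bound (m : aexpr) (P : list lin) (k : aexpr -> ctree) : ctree :=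
  match P with
  | nil => k m
  | t :: P =>
      CBranch (ASub m (lower_bound t)) (max_lower_bound (lower_bound t) P k)
        (max_lower_bound m P k) (max_lower_bound m P k)
  end.

Fixpoint check_at (m : aexpr) (cs : list lin) : ctree :=
  match cs with
  | nil => CLeaf (Some m)
  | t :: cs =>
      CBranch (AAdd (AMul (coef 0 t) m) (constant_term t))
        (CLeaf None) (check_at m cs) (check_at m cs)
  end.

(** The highest variable goes first, so variable 0, the objective, is left at the end. The only
    candidate for the minimum is then the greatest lower bound, 0 included, and it is tested against
    all of [cs]. *)
Fixpoint minimise (n : nat) (cs : list lin) : ctree :=
  match n with
  | 0%nat => by_sign 0 cs (fun P _ _ => max_lower_bound (ACst 0) P (fun m => check_at m cs))
  | S n' => by_sign n cs (fun P N Z => minimise n' (eliminate n P N Z))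
  end.

Lemma max_lower_bound_spec inp k P : forall m,
  exists b, ceval inp (max_lower_bound m P k) = ceval inp (k b) /\
    aeval inp m <= aeval inp b /\
    (forall t, In t P -> aeval inp (lower_bound t) <= aeval inp b) /\
    (b = m \/ exists t, In t P /\ b = lower_bound t).
Proof.
  induction P as [|t P IH]; intros m.
  - exists m; simpl; repeat split; auto with real; tauto.
  - cbn [max_lower_bound ceval aeval In].
    set (l := lower_bound t).
    destruct (Rlt_dec (aeval inp m - aeval inp l) 0) as [Hl|Hl].
    + destruct (IH l) as (b & E & Hb & Ha & Ho); exists b; split; [exact E|].
      split; [lra|]; split.
      * intros u [<-|Hu]; [exact Hb|exact (Ha u Hu)].
      * right; destruct Ho as [->|[u [Hu ->]]]; eauto.
    + destruct (IH m) as (b & E & Hb & Ha & Ho); exists b; split.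
      { destruct (Req_EM_T (aeval inp m - aeval inp l) 0); exact E. }
      split; [lra|]; split.
      * intros u [<-|Hu]; [fold l; lra|exact (Ha u Hu)].
      * destruct Ho as [->|[u [Hu ->]]]; eauto.
Qed.

Lemma check_at_spec inp m cs :
  let ok t := 0 <= aeval inp (coef 0 t) * aeval inp m + aeval inp (constant_term t) in
  (ceval inp (check_at m cs) = Some (aeval inp m) /\ forall t, In t cs -> ok t) \/
  (ceval inp (check_at m cs) = None /\ exists t, In t cs /\ ~ ok t).
Proof.
  intros ok; induction cs as [|t cs IH]; simpl.
  - left; split; [reflexivity|tauto].
  - fold (ok t) in *; unfold ok in *.
    set (w := aeval inp (coef 0 t) * aeval inp m + aeval inp (constant_term t)) in *.
    destruct (Rlt_dec w 0).
    + right; split; [reflexivity|]; exists t; split; [auto|fold w; lra].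
    + destruct IH as [[E Ha]|[E [u [Hu Hn]]]].
      * left; split; [destruct (Req_EM_T w 0); exact E|].
        intros u [<-|Hu]; [fold w; lra|exact (Ha u Hu)].
      * right; split; [destruct (Req_EM_T w 0); exact E|eauto].
Qed.

Lemma minimise_spec n : forall cs,
  (forall t, In t cs -> (width t <= n + 1)%nat) ->
  computes_min (minimise n cs)
    (fun inp v => 0 <= v /\ exists env, env 0%nat = v /\ sat inp env cs).
Proof.
  induction n as [|n IH]; intros cs HW inp; simpl.
  - destruct (by_sign_spec inp 0 cs
      (fun P _ _ => max_lower_bound (ACst 0) P (fun m => check_at m cs)))
      as (P & N & Z & -> & HP & _ & _).
    destruct (max_lower_bound_spec inp (fun m => check_at m cs) P (ACst 0))
      as (b & -> & Hb0 & HbP & Hb).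
    simpl in Hb0.
    assert (Hval : forall env t, In t cs ->
      lval inp env t = aeval inp (coef 0 t) * env 0%nat + aeval inp (constant_term t)).
    { intros env t Ht; apply lval_width1; exact (HW t Ht). }
    assert (Hdiv : forall t, In t P -> aeval inp (coef 0 t) * aeval inp (lower_bound t)
                     = - aeval inp (constant_term t) /\ 0 < aeval inp (coef 0 t)).
    { intros t Ht; apply HP in Ht; destruct Ht as [_ Ht]; split; [|exact Ht]; simpl.
      destruct (Req_EM_T (aeval inp (coef 0 t)) 0); [lra|field; lra]. }
    assert (Hmin : forall v, 0 <= v -> (exists env, env 0%nat = v /\ sat inp env cs) ->
                     aeval inp b <= v).
    { intros v Hv [env [E Hs]]; destruct Hb as [->|[t [Ht ->]]]; [exact Hv|].
      destruct (Hdiv t Ht) as [D Dp]; apply HP in Ht; destruct Ht as [Ht _].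
      specialize (Hs t Ht); rewrite (Hval env t Ht), E in Hs.
      apply Rmult_le_reg_l with (aeval inp (coef 0 t)); lra. }
    destruct (check_at_spec inp b cs) as [[-> Hok]|[-> [t [Ht Hno]]]].
    + split.
      * split; [exact Hb0|]; exists (fun _ => aeval inp b); split; [reflexivity|].
        intros t Ht; rewrite (Hval _ t Ht); exact (Hok t Ht).
      * intros w [Hw He]; exact (Hmin w Hw He).
    + intros v [Hv He]; apply Hno.
      assert (Hbv := Hmin v Hv He); destruct He as [env [E Hs]].
      specialize (Hs t Ht); rewrite (Hval env t Ht), E in Hs.
      destruct (Rlt_dec 0 (aeval inp (coef 0 t))) as [Hp|Hp].
      * assert (HtP : In t P) by (apply HP; auto).
        destruct (Hdiv t HtP) as [D _]; specialize (HbP t HtP).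
        apply Rmult_le_compat_l with (r := aeval inp (coef 0 t)) in HbP; lra.
      * assert (H : - aeval inp (coef 0 t) * aeval inp b <= - aeval inp (coef 0 t) * v)
          by (apply Rmult_le_compat_l; lra).
        lra.
  - destruct (by_sign_spec inp (S n) cs
      (fun P N Z => minimise n (eliminate (S n) P N Z)))
      as (P & N & Z & E & HP & HN & HZ).
    simpl in E; rewrite E.
    assert (HW' : forall t, In t cs -> (width t <= S (S n))%nat)
      by (intros t Ht; specialize (HW t Ht); lia).
    assert (Heq := fun v => eliminate_spec inp (S n) cs P N Z v HP HN HZ HW'
                     (Nat.neq_succ_0 n)).
    assert (HE : forall t, In t (eliminate (S n) P N Z) -> (width t <= n + 1)%nat).
    { intros t Ht; replace (n + 1)%nat with (S n) by lia.
      apply In_eliminate in Ht; destruct Ht as [[u [Hu ->]]|[u [w [Hu [Hw ->]]]]].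
      - apply width_remove_var, HW', HZ, Hu.
      - simpl; apply Nat.max_lub; apply width_remove_var, HW';
          [apply HN, Hw|apply HP, Hu]. }
    specialize (IH _ HE inp).
    destruct (ceval inp (minimise n (eliminate (S n) P N Z))).
    + destruct IH as [[H0 H1] H2]; split; [split; [exact H0|apply Heq, H1]|].
      intros w [Hw He]; apply H2; split; [exact Hw|apply Heq, He].
    + intros v [Hv He]; apply (IH v); split; [exact Hv|apply Heq, He].
Qed.

Lemma linear_system_min_computable cs :
  min_computable (fun inp v => 0 <= v /\ exists env, env 0%nat = v /\ sat inp env cs).
Proof.
  exists (minimise (list_max (map width cs)) cs); apply minimise_spec.
  intros t Ht.
  assert (H := proj1 (list_max_le (map width cs) _) (le_n _)).
  rewrite Forall_forall in H; specialize (H (width t) (in_map width cs t Ht)); lia.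
Qed.

(** * Schedules made of straight legs *)

Inductive dir : Type := West | East | South | North.

Definition dir_eq_dec (d e : dir) : {d = e} + {d <> e}.
Proof. decide equality. Defined.

Definition dirs : list dir := [West; East; South; North].

(** Nonnegative when [q] lies in direction [d] from [p], far enough for the squares to have disjoint
    interiors. It is affine in both positions, which is the convexity that straight legs rely on. *)
Definition gap (d : dir) (p q : pt) : R :=
  match d with
  | West => fst p - fst q - 1
  | East => fst q - fst p - 1
  | South => snd p - snd q - 1
  | North => snd q - snd p - 1
  end.

Lemma in_F2_gap p q : in_F2 p q <-> exists d, In d dirs /\ 0 <= gap d p q.
Proof.
  unfold in_F2, linf, dirs; split.
  - intros H.
    assert (H' : 1 <= Rabs (fst p - fst q) \/ 1 <= Rabs (snd p - snd q)).
    { destruct (Rle_dec (Rabs (fst p - fst q)) (Rabs (snd p - snd q))).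
      - rewrite Rmax_right in H; auto.
      - rewrite Rmax_left in H; lra. }
    destruct H' as [H'|H']; revert H'; unfold Rabs; destruct Rcase_abs; intros H'.
    + exists East; simpl; split; [tauto|lra].
    + exists West; simpl; split; [tauto|lra].
    + exists North; simpl; split; [tauto|lra].
    + exists South; simpl; split; [tauto|lra].
  - intros [d [_ H]]; destruct d; simpl in H;
      ((apply Rle_trans with (2 := Rmax_l _ _); unfold Rabs; destruct Rcase_abs; lra) ||
       (apply Rle_trans with (2 := Rmax_r _ _); unfold Rabs; destruct Rcase_abs; lra)).
Qed.

Lemma l1_triangle p q r : l1 p r <= l1 p q + l1 q r.
Proof.
  unfold l1.
  assert (H1 := Rabs_triang (fst p - fst q) (fst q - fst r)).
  assert (H2 := Rabs_triang (snd p - snd q) (snd q - snd r)).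
  replace (fst p - fst q + (fst q - fst r)) with (fst p - fst r) in H1 by ring.
  replace (snd p - snd q + (snd q - snd r)) with (snd p - snd r) in H2 by ring.
  lra.
Qed.

Lemma l1_sym p q : l1 p q = l1 q p.
Proof. unfold l1; rewrite (Rabs_minus_sym (fst p)), (Rabs_minus_sym (snd p)); reflexivity. Qed.

Lemma l1_nonneg p q : 0 <= l1 p q.
Proof. unfold l1; apply Rplus_le_le_0_compat; apply Rabs_pos. Qed.

Lemma l1_le0_eq p q : l1 p q <= 0 -> p = q.
Proof.
  destruct p, q; unfold l1; simpl; unfold Rabs; intros H.
  repeat destruct Rcase_abs in H; f_equal; lra.
Qed.

(** The four sign choices of the two absolute values turn a distance bound into linear
    constraints. *)
Lemma l1_le_iff p q e :
  l1 p q <= e <->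
  (fst p - fst q) + (snd p - snd q) <= e /\ (fst p - fst q) - (snd p - snd q) <= e /\
  - (fst p - fst q) + (snd p - snd q) <= e /\ - (fst p - fst q) - (snd p - snd q) <= e.
Proof. unfold l1, Rabs; repeat destruct Rcase_abs; split; lra. Qed.

Lemma gap_lipschitz d p q p' q' : Rabs (gap d p q - gap d p' q') <= l1 p p' + l1 q q'.
Proof.
  unfold l1; destruct d; simpl; unfold Rabs; repeat destruct Rcase_abs; lra.
Qed.

(** A straight move of duration [e] for both robots. Conditions at its two ends suffice, because the
    gap is affine along the move. *)
Definition leg (d : dir) (e : R) (p q p' q' : pt) : Prop :=
  l1 p p' <= e /\ l1 q q' <= e /\ 0 <= gap d p q /\ 0 <= gap d p' q'.

(* An environment lists, for each break point [k], the time left until the end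
   of the schedule and then the coordinates of the two robots.  The product is
   written [k * 5] so that [S k * 5] is convertible to [5 + k * 5]. *)
Definition time_left (env : nat -> R) (k : nat) : R := env (k * 5)%nat.
Definition robot1 (env : nat -> R) (k : nat) : pt := (env (k * 5 + 1)%nat, env (k * 5 + 2)%nat).
Definition robot2 (env : nat -> R) (k : nat) : pt := (env (k * 5 + 3)%nat, env (k * 5 + 4)%nat).

Definition env_cons (e : R) (p q : pt) (env : nat -> R) (i : nat) : R :=
  match i with
  | 0 => e
  | 1 => fst p
  | 2 => snd p
  | 3 => fst q
  | 4 => snd q
  | S (S (S (S (S j)))) => env j
  end%nat.

(** Counting the time left, rather than the time elapsed, makes variable 0 the whole makespan. *)
Fixpoint legs (env : nat -> R) (k : nat) (ds : list dir) : Prop :=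
  match ds with
  | nil => time_left env k = 0
  | d :: ds =>
      leg d (time_left env k - time_left env (S k))
        (robot1 env k) (robot2 env k) (robot1 env (S k)) (robot2 env (S k)) /\
      legs env (S k) ds
  end.

Lemma legs_env_cons e p q env ds : forall k,
  legs env k ds -> legs (env_cons e p q env) (S k) ds.
Proof.
  induction ds as [|d ds IH]; intros k; [exact (fun H => H)|].
  intros [H1 H2]; split; [exact H1|exact (IH _ H2)].
Qed.

(** * From a schedule to straight legs *)

Definition lipschitz_on (t0 t1 : R) (m : R -> pt) : Prop :=
  forall s t, t0 <= s <= t1 -> t0 <= t <= t1 -> l1 (m s) (m t) <= Rabs (s - t).

(** [c] is the supremum of the times at which [g] is nonnegative; continuity puts [c] among them.
    The constant 2 is the rate at which two robots of speed 1 can change a gap. *)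
Lemma last_nonneg_time (g : R -> R) (a b : R) :
  a <= b ->
  (forall s t, a <= s <= b -> a <= t <= b -> Rabs (g s - g t) <= 2 * Rabs (s - t)) ->
  0 <= g a ->
  exists c, a <= c <= b /\ 0 <= g c /\ forall t, c < t <= b -> g t < 0.
Proof.
  intros Hab Hg Ha.
  destruct (completeness (fun t => a <= t <= b /\ 0 <= g t)) as [c [Hc1 Hc2]].
  { exists b; intros t [Ht _]; lra. }
  { exists a; split; [lra|exact Ha]. }
  assert (Hac : a <= c) by (apply Hc1; split; [lra|exact Ha]).
  assert (Hcb : c <= b) by (apply Hc2; intros t [Ht _]; lra).
  exists c; split; [lra|]; split.
  - destruct (Rle_dec 0 (g c)) as [|Hn]; [assumption|exfalso].
    (* If [g c < 0], the Lipschitz bound keeps [g] negative for a time [- g c / 2] before [c], which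
       contradicts the choice of [c] as least upper bound. *)
    assert (Hub : is_upper_bound (fun t => a <= t <= b /\ 0 <= g t) (c + g c / 2)).
    { intros t [Ht Hgt].
      assert (Htc : t <= c) by (apply Hc1; split; assumption).
      assert (H := Hg t c Ht (conj Hac Hcb)).
      rewrite (Rabs_left1 (t - c)) in H by lra.
      assert (H' := Rle_abs (g t - g c)); lra. }
    specialize (Hc2 _ Hub); lra.
  - intros t Ht; destruct (Rlt_dec (g t) 0) as [|Hn]; [assumption|exfalso].
    assert (t <= c) by (apply Hc1; split; lra); lra.
Qed.

Lemma negative_margin (A : Type) (f : A -> R) (l : list A) :
  (forall x, In x l -> f x < 0) -> exists e, 0 < e /\ forall x, In x l -> f x <= - e.
Proof.
  intros H; destruct (list_has_max A f l) as [->|[x [Hx Hm]]].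
  - exists 1; simpl; split; [lra|tauto].
  - exists (- f x); split; [specialize (H x Hx); lra|].
    intros y Hy; specialize (Hm y Hy); lra.
Qed.

(** [l] lists the half-planes that may still be visited. Each leg ends at the last visit to its
    half-plane, which is then removed from [l]; so there are at most [n] legs. All break points and
    break times are those of the given schedule. *)
Lemma schedule_to_legs (m1 m2 : R -> pt) (t1 : R) : forall n (l : list dir) t0,
  (length l <= n)%nat -> t0 <= t1 ->
  lipschitz_on t0 t1 m1 -> lipschitz_on t0 t1 m2 ->
  (forall t, t0 <= t <= t1 -> exists d, In d l /\ 0 <= gap d (m1 t) (m2 t)) ->
  exists ds env, ds <> nil /\ (length ds <= n)%nat /\ legs env 0 ds /\ time_left env 0 = t1 - t0 /\
    robot1 env 0 = m1 t0 /\ robot2 env 0 = m2 t0 /\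
    robot1 env (length ds) = m1 t1 /\ robot2 env (length ds) = m2 t1.
Proof.
  induction n as [|n IH]; intros l t0 Hl Ht L1 L2 Hd.
  { destruct l; simpl in Hl; [|lia].
    destruct (Hd t0) as [d [[] _]]; lra. }
  destruct (Hd t0) as [d [Hdl Hd0]]; [lra|].
  assert (G : forall e s t, t0 <= s <= t1 -> t0 <= t <= t1 ->
    Rabs (gap e (m1 s) (m2 s) - gap e (m1 t) (m2 t)) <= 2 * Rabs (s - t)).
  { intros e s t Hs Ht'.
    assert (H := gap_lipschitz e (m1 s) (m2 s) (m1 t) (m2 t)).
    specialize (L1 s t Hs Ht'); specialize (L2 s t Hs Ht'); lra. }
  destruct (last_nonneg_time (fun t => gap d (m1 t) (m2 t)) t0 t1 Ht (G d) Hd0)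
    as (c & Hc & Hgc & Hlast).
  assert (Hleg : leg d (c - t0) (m1 t0) (m2 t0) (m1 c) (m2 c)).
  { assert (E : Rabs (t0 - c) = c - t0) by (rewrite Rabs_left1 by lra; ring).
    split; [|split; [|split; assumption]]; rewrite <- E; [apply L1|apply L2]; lra. }
  destruct (Rle_lt_dec t1 c) as [Hct|Hct].
  - assert (c = t1) as -> by lra.
    exists [d], (env_cons (t1 - t0) (m1 t0) (m2 t0)
                  (env_cons 0 (m1 t1) (m2 t1) (fun _ => 0))).
    unfold legs, time_left, robot1, robot2; cbn [env_cons Nat.mul Nat.add length].
    rewrite <- !surjective_pairing, Rminus_0_r.
    repeat split; try apply Hleg; try lia; discriminate.
  - assert (Hd' : forall t, c <= t <= t1 -> exists e, In e (remove dir_eq_dec d l) /\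
                    0 <= gap e (m1 t) (m2 t)).
    { assert (Hgt : forall t, c < t <= t1 -> exists e, In e (remove dir_eq_dec d l) /\
                      0 <= gap e (m1 t) (m2 t)).
      { intros t Hct'; destruct (Hd t) as [e [He1 He2]]; [lra|].
        exists e; split; [apply in_in_remove; [|exact He1]|exact He2].
        intros ->; specialize (Hlast t Hct'); simpl in Hlast; lra. }
      intros t Hct'; destruct (Req_dec t c) as [->|]; [|apply Hgt; lra].
      (* At time [c] itself: if all remaining gaps were negative, they would share a margin, being
         finitely many, and would stay negative just after [c], against [Hgt]. *)
      apply NNPP; intros Hn.
      destruct (negative_margin dir (fun e => gap e (m1 c) (m2 c)) (remove dir_eq_dec d l))
        as [eps [Heps Hall]].
      { intros e He; destruct (Rlt_dec (gap e (m1 c) (m2 c)) 0) as [|H]; [assumption|].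
        exfalso; apply Hn; exists e; split; [exact He|lra]. }
      (* Within time [eps / 4] a gap changes by at most [eps / 2], less than the margin. *)
      set (u := Rmin t1 (c + eps / 4)).
      assert (Hu : c < u <= t1 /\ u <= c + eps / 4).
      { unfold u, Rmin; destruct Rle_dec; lra. }
      destruct (Hgt u) as [e [He1 He2]]; [lra|].
      specialize (Hall e He1).
      assert (H : Rabs (gap e (m1 u) (m2 u) - gap e (m1 c) (m2 c)) <= 2 * Rabs (u - c))
        by (apply G; lra).
      rewrite (Rabs_right (u - c)) in H by lra.
      assert (H' := Rle_abs (gap e (m1 u) (m2 u) - gap e (m1 c) (m2 c))).
      simpl in Hall; lra. }
    destruct (IH (remove dir_eq_dec d l) c) as (ds & env & _ & Hlen & HL & HT & HA & HB & HA' & HB').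
    { assert (H := remove_length_lt dir_eq_dec l d Hdl); lia. }
    { lra. }
    { intros s t Hs Ht'; apply L1; lra. }
    { intros s t Hs Ht'; apply L2; lra. }
    { exact Hd'. }
    exists (d :: ds), (env_cons (t1 - t0) (m1 t0) (m2 t0) env).
    split; [discriminate|]; split; [simpl; lia|]; split; [split; [|apply legs_env_cons; exact HL]|].
    + change (leg d (t1 - t0 - time_left env 0) (fst (m1 t0), snd (m1 t0))
        (fst (m2 t0), snd (m2 t0)) (robot1 env 0) (robot2 env 0)).
      rewrite HT, HA, HB, <- !surjective_pairing.
      replace (t1 - t0 - (t1 - c)) with (c - t0) by ring; exact Hleg.
    + split; [reflexivity|]; split; [symmetry; apply surjective_pairing|].
      split; [symmetry; apply surjective_pairing|]; split; assumption.
Qed.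

(** * From straight legs to a schedule *)

Definition lerp (p p' : pt) (s : R) : pt :=
  (fst p + s * (fst p' - fst p), snd p + s * (snd p' - snd p)).

(* If [e = 0] then the first leg is the single time [t0], where the parameter
   [(t0 - t0) / 0] is [0]. *)
Definition prepend (t0 e : R) (p p' : pt) (m : R -> pt) (t : R) : pt :=
  if Rle_dec t (t0 + e) then lerp p p' ((t - t0) / e) else m t.

(** A trajectory whose chain is explicit, so that a vertex can be put in front of it. *)
Definition follows_chain (t0 t1 : R) (m : R -> pt) (l : list pt) : Prop :=
  t0 <= t1 /\ lipschitz_on t0 t1 m /\
  forall q, (exists t, t0 <= t <= t1 /\ m t = q) <-> on_chain l q.

Lemma lerp_1 p p' : lerp p p' 1 = p'.
Proof. destruct p, p'; unfold lerp; simpl; f_equal; ring. Qed.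

Lemma lerp_0 p p' : lerp p p' 0 = p.
Proof. destruct p, p'; unfold lerp; simpl; f_equal; ring. Qed.

Lemma l1_lerp p p' s t : l1 (lerp p p' s) (lerp p p' t) = Rabs (s - t) * l1 p p'.
Proof.
  unfold l1, lerp; simpl.
  rewrite (Rabs_minus_sym (fst p)), (Rabs_minus_sym (snd p)), Rmult_plus_distr_l,
    <- !Rabs_mult.
  f_equal; f_equal; ring.
Qed.

Lemma gap_lerp d p p' q q' s :
  gap d (lerp p p' s) (lerp q q' s) = (1 - s) * gap d p q + s * gap d p' q'.
Proof. destruct d; simpl; ring. Qed.

Lemma leg_parameter_bounds t0 e t : 0 <= e -> t0 <= t <= t0 + e -> 0 <= (t - t0) / e <= 1.
Proof.
  intros He Ht; destruct (Req_dec e 0) as [->|].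
  - replace (t - t0) with 0 by lra; unfold Rdiv; rewrite Rmult_0_l; lra.
  - split.
    + apply Rmult_le_pos; [lra|left; apply Rinv_0_lt_compat; lra].
    + apply Rmult_le_reg_r with e; [lra|].
      replace ((t - t0) / e * e) with (t - t0) by (field; lra); lra.
Qed.

Lemma prepend_start t0 e p p' m : 0 <= e -> prepend t0 e p p' m t0 = p.
Proof.
  intros He; unfold prepend; destruct Rle_dec; [|lra].
  replace ((t0 - t0) / e) with 0 by (unfold Rdiv; ring); apply lerp_0.
Qed.

(** At the junction both formulas give [p']. If [e = 0], the leg has length 0 and [p = p']. *)
Lemma prepend_after t0 e p p' m t :
  l1 p p' <= e -> m (t0 + e) = p' -> t0 + e <= t -> prepend t0 e p p' m t = m t.
Proof.
  intros Hl Hm Ht; unfold prepend; destruct Rle_dec as [Hle|]; [|reflexivity].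
  assert (t = t0 + e) as -> by lra.
  destruct (Req_dec e 0) as [->|].
  - rewrite Hm, (l1_le0_eq p p' Hl); unfold lerp; destruct p'; simpl; f_equal; ring.
  - replace ((t0 + e - t0) / e) with 1 by (field; assumption).
    rewrite lerp_1; symmetry; exact Hm.
Qed.

(** The leg traces the new segment and [m] the old chain. The Lipschitz bound for times on different
    sides of [t0 + e] follows from the triangle inequality through the junction. *)
Lemma prepend_follows_chain t0 e t1 p p' m l :
  l1 p p' <= e -> m (t0 + e) = p' -> follows_chain (t0 + e) t1 m (p' :: l) ->
  follows_chain t0 t1 (prepend t0 e p p' m) (p :: p' :: l).
Proof.
  intros Hl Hm [Ht [HL Him]].
  assert (He := Rle_trans _ _ _ (l1_nonneg p p') Hl).
  set (m' := prepend t0 e p p' m).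
  assert (Hin : forall t, t0 + e <= t -> m' t = m t)
    by (intros t Hte; apply prepend_after; assumption).
  assert (Hbe : forall t, t <= t0 + e -> m' t = lerp p p' ((t - t0) / e)).
  { intros t Hte; unfold m', prepend; destruct Rle_dec; [reflexivity|contradiction]. }
  assert (L0 : forall s t, t0 <= s <= t0 + e -> t0 <= t <= t0 + e ->
                 l1 (m' s) (m' t) <= Rabs (s - t)).
  { intros s t Hs Ht'; rewrite !Hbe, l1_lerp by lra.
    destruct (Req_dec e 0) as [->|Hne].
    - replace (l1 p p') with 0 by (assert (H := l1_nonneg p p'); lra).
      rewrite Rmult_0_r; apply Rabs_pos.
    - replace ((s - t0) / e - (t - t0) / e) with ((s - t) / e) by (field; exact Hne).
      unfold Rdiv; rewrite Rabs_mult, (Rabs_right (/ e))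
        by (left; apply Rinv_0_lt_compat; lra).
      rewrite Rmult_assoc.
      rewrite <- (Rmult_1_r (Rabs (s - t))) at 2.
      apply Rmult_le_compat_l; [apply Rabs_pos|].
      apply Rmult_le_reg_l with e; [lra|].
      rewrite <- Rmult_assoc, Rinv_r, Rmult_1_l by exact Hne; lra. }
  assert (Lm : forall s t, t0 <= s <= t0 + e -> t0 + e <= t <= t1 ->
                 l1 (m' s) (m' t) <= t - s).
  { intros s t Hs Ht'.
    assert (H := l1_triangle (m' s) (m' (t0 + e)) (m' t)).
    assert (H1 := L0 s (t0 + e) Hs); rewrite Rabs_left1 in H1 by lra.
    assert (H2 := HL (t0 + e) t); rewrite Rabs_left1 in H2 by lra.
    rewrite <- !Hin in H2 by lra.
    specialize (H1 ltac:(lra)); specialize (H2 ltac:(lra) ltac:(lra)); lra. }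
  split; [lra|]; split.
  - intros s t Hs Ht'.
    destruct (Rle_dec s (t0 + e)), (Rle_dec t (t0 + e)).
    + apply L0; lra.
    + rewrite Rabs_left1 by lra.
      replace (- (s - t)) with (t - s) by ring; apply Lm; lra.
    + rewrite Rabs_right, l1_sym by lra; apply Lm; lra.
    + rewrite !Hin by lra; apply HL; lra.
  - intros q.
    change (on_chain (p :: p' :: l) q) with (on_seg p p' q \/ on_chain (p' :: l) q).
    rewrite <- Him; split.
    + intros [t [Ht' <-]]; destruct (Rle_dec t (t0 + e)).
      * left; exists ((t - t0) / e); split; [apply leg_parameter_bounds; lra|].
        apply Hbe; assumption.
      * right; exists t; split; [lra|symmetry; apply Hin; lra].
    + intros [[s [Hs ->]]|[t [Ht' <-]]].
      * assert (Hse : 0 <= s * e <= e).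
        { split; [apply Rmult_le_pos; lra|].
          rewrite <- (Rmult_1_l e) at 2; apply Rmult_le_compat_r; lra. }
        exists (t0 + s * e); split; [lra|]; rewrite Hbe by lra.
        change (lerp p p' ((t0 + s * e - t0) / e) = lerp p p' s).
        (* For [e = 0] the segment is a single point, whatever [s] is. *)
        destruct (Req_dec e 0) as [->|Hne].
        -- rewrite (l1_le0_eq p p' Hl); unfold lerp; f_equal; ring.
        -- f_equal; field; exact Hne.
      * exists t; split; [lra|apply Hin; lra].
Qed.

(** The last leg separates the robots at its end. An empty word would impose no separation at all,
    hence [ds <> nil]. *)
Lemma legs_end_in_F2 env ds : forall k,
  ds <> nil -> legs env k ds ->
  in_F2 (robot1 env (k + length ds)) (robot2 env (k + length ds)).
Proof.
  induction ds as [|d ds IH]; intros k Hn HL; [contradiction|].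
  destruct HL as [Hleg HL]; cbn [length]; rewrite <- Nat.add_succ_comm.
  destruct ds as [|d' ds]; [|apply IH; [discriminate|exact HL]].
  apply in_F2_gap; exists d; split; [destruct d; simpl; tauto|].
  rewrite Nat.add_0_r; apply Hleg.
Qed.

(** The start time is general because the induction hypothesis is used at the end of the first leg.
    Separation at the last break point covers the base case, a single instant. *)
Lemma legs_to_schedule env ds : forall k t0,
  legs env k ds -> in_F2 (robot1 env (k + length ds)) (robot2 env (k + length ds)) ->
  exists m1 m2 c1 c2,
    let t1 := t0 + time_left env k in
    follows_chain t0 t1 m1 (robot1 env k :: c1) /\
    follows_chain t0 t1 m2 (robot2 env k :: c2) /\
    (forall t, t0 <= t <= t1 -> in_F2 (m1 t) (m2 t)) /\
    m1 t0 = robot1 env k /\ m2 t0 = robot2 env k /\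
    m1 t1 = robot1 env (k + length ds) /\ m2 t1 = robot2 env (k + length ds).
Proof.
  induction ds as [|d ds IH]; intros k t0 HL HF.
  - simpl in HL, HF; rewrite Nat.add_0_r in HF.
    exists (fun _ => robot1 env k), (fun _ => robot2 env k), nil, nil.
    rewrite HL; cbn [length]; rewrite Nat.add_0_r.
    assert (C : forall p, follows_chain t0 (t0 + 0) (fun _ => p) [p]).
    { intros p; split; [lra|]; split.
      - intros s t _ _; apply Rle_trans with 0; [|apply Rabs_pos].
        unfold l1; rewrite !Rminus_diag, Rabs_R0; lra.
      - intros q; simpl; split.
        + intros [t [_ H]]; congruence.
        + intros ->; exists t0; split; [lra|reflexivity]. }
    cbv zeta; split; [apply C|]; split; [apply C|]; auto.
  - destruct HL as [Hleg HL].
    set (e := time_left env k - time_left env (S k)) in *.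
    cbn [length] in *; rewrite <- Nat.add_succ_comm in *.
    destruct (IH (S k) (t0 + e) HL HF)
      as (m1 & m2 & c1 & c2 & F1 & F2 & Hfree & A0 & B0 & A1 & B1).
    replace (t0 + e + time_left env (S k)) with (t0 + time_left env k) in *
      by (unfold e; ring).
    destruct Hleg as (Hl1 & Hl2 & G0 & G1).
    assert (He := Rle_trans _ _ _ (l1_nonneg _ _) Hl1).
    assert (Hte : t0 + e <= t0 + time_left env k) by apply F1.
    exists (prepend t0 e (robot1 env k) (robot1 env (S k)) m1),
           (prepend t0 e (robot2 env k) (robot2 env (S k)) m2),
           (robot1 env (S k) :: c1), (robot2 env (S k) :: c2).
    cbv zeta; split; [apply prepend_follows_chain; assumption|].
    split; [apply prepend_follows_chain; assumption|].
    rewrite !prepend_start, !(prepend_after _ _ _ _ _ (t0 + time_left env k)) by assumption.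
    split; [|auto].
    intros t Ht; destruct (Rle_dec (t0 + e) t) as [Hle|Hgt].
    + rewrite !prepend_after by assumption; apply Hfree; lra.
    + unfold prepend; destruct Rle_dec; [|lra].
      apply in_F2_gap; exists d; split; [destruct d; simpl; tauto|].
      assert (Hs := leg_parameter_bounds t0 e t He ltac:(lra)).
      (* During a leg the gap is a convex combination of its two nonnegative end values. *)
      rewrite gap_lerp; apply Rplus_le_le_0_compat; apply Rmult_le_pos; lra.
Qed.

(** * The linear systems *)

Definition LSub (t u : lin) : lin := LAdd t (LScale (ACst (-1)) u).
Definition vtime (k : nat) : lin := LVar (k * 5).

Definition vpt : Type := (lin * lin)%type.
Definition vrobot1 (k : nat) : vpt := (LVar (k * 5 + 1), LVar (k * 5 + 2)).
Definition vrobot2 (k : nat) : vpt := (LVar (k * 5 + 3), LVar (k * 5 + 4)).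

Definition pval (inp : list R) (env : nat -> R) (p : vpt) : pt :=
  (lval inp env (fst p), lval inp env (snd p)).

Definition l1_system (e : lin) (p q : vpt) : list lin :=
  let dx := LSub (fst p) (fst q) in
  let dy := LSub (snd p) (snd q) in
  [LSub e (LAdd dx dy); LSub e (LSub dx dy); LAdd e (LSub dx dy); LAdd e (LAdd dx dy)].

Definition lgap (d : dir) (p q : vpt) : lin :=
  match d with
  | West => LSub (LSub (fst p) (fst q)) (LCst (ACst 1))
  | East => LSub (LSub (fst q) (fst p)) (LCst (ACst 1))
  | South => LSub (LSub (snd p) (snd q)) (LCst (ACst 1))
  | North => LSub (LSub (snd q) (snd p)) (LCst (ACst 1))
  end.

Definition leg_system (d : dir) (e : lin) (p q p' q' : vpt) : list lin :=
  l1_system e p p' ++ l1_system e q q' ++ [lgap d p q; lgap d p' q'].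

Fixpoint legs_system (k : nat) (ds : list dir) : list lin :=
  match ds with
  | nil => [vtime k; LSub (LCst (ACst 0)) (vtime k)]
  | d :: ds =>
      leg_system d (LSub (vtime k) (vtime (S k)))
        (vrobot1 k) (vrobot2 k) (vrobot1 (S k)) (vrobot2 (S k)) ++
      legs_system (S k) ds
  end.

Definition htrap_at (inp : list R) (j : nat) : htrap :=
  let x i := nth (j + i) inp 0 in
  Htrap (x 0%nat) (x 1%nat) (x 2%nat) (x 3%nat) (x 4%nat) (x 5%nat).

(** Membership with the side inequalities multiplied by the height: the division disappears, and
    positivity of the height makes this an equivalence. *)
Definition htrap_system (j : nat) (p : vpt) : list lin :=
  (let x i := AInp (j + i) in
   let height := ASub (x 1) (x 0) in
   let y := LSub (snd p) (LCst (x 0)) in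
   [y; LSub (LCst (x 1)) (snd p);
   LSub (LScale height (LSub (fst p) (LCst (x 2)))) (LScale (ASub (x 4) (x 2)) y);
   LSub (LScale (ASub (x 5) (x 3)) y) (LScale height (LSub (fst p) (LCst (x 3))))])%nat.

(* For an integer [s] in [-2, 2], this is positive if [s = c] and zero otherwise. *)
Definition selector (s : aexpr) (c : Z) : aexpr :=
  fold_right (fun b a => if Z.eqb b c then a else
      AMul (AMul (ASub s (ACst b)) (ASub s (ACst b))) a)
    (ACst 1) [-2; -1; 0; 1; 2]%Z.

(** The selector turns a constraint that does not apply into [0 <= 0], so one system covers every
    value of the state's sign. *)
Definition sigma_system (s : aexpr) (p q : vpt) : list lin :=
  [LScale (selector s 1) (LSub (LAdd (fst q) (LCst (ACst 1))) (fst p));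
   LScale (selector s (-1)) (LAdd (LSub (fst p) (fst q)) (LCst (ACst 1)));
   LScale (selector s 2) (LSub (LAdd (snd q) (LCst (ACst 1))) (snd p));
   LScale (selector s (-2)) (LAdd (LSub (snd p) (snd q)) (LCst (ACst 1)))].

(** [j] is the offset of the state in the input, which takes 6 + 6 + 1 = 13 entries, and [k] the
    break point. Separation of the robots is left to the legs. *)
Definition state_system (j k : nat) : list lin :=
  htrap_system j (vrobot1 k) ++ htrap_system (j + 6) (vrobot2 k) ++
  sigma_system (AInp (j + 12)) (vrobot1 k) (vrobot2 k).

Definition schedule_system (ds : list dir) : list lin :=
  state_system 0 0 ++ legs_system 0 ds ++ state_system 13 (length ds).

(** * Correctness of the linear systems *)

Lemma sat_nil inp env : sat inp env nil <-> True.
Proof. unfold sat; simpl; tauto. Qed.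

Lemma sat_cons inp env t cs : sat inp env (t :: cs) <-> 0 <= lval inp env t /\ sat inp env cs.
Proof.
  unfold sat; simpl; split.
  - auto.
  - intros [H1 H2] u [<-|Hu]; auto.
Qed.

Lemma sat_app inp env cs ds : sat inp env (cs ++ ds) <-> sat inp env cs /\ sat inp env ds.
Proof.
  unfold sat; split.
  - intros H; split; intros t Ht; apply H, in_or_app; auto.
  - intros [H1 H2] t Ht; apply in_app_or in Ht; destruct Ht; auto.
Qed.

Lemma sat_l1_system inp env e p q :
  sat inp env (l1_system e p q) <-> l1 (pval inp env p) (pval inp env q) <= lval inp env e.
Proof.
  unfold l1_system; rewrite !sat_cons, sat_nil, l1_le_iff; simpl; split.
  - intros H; repeat split; lra.
  - intros H; repeat split; lra.
Qed.

Lemma lval_lgap inp env d p q :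
  lval inp env (lgap d p q) = gap d (pval inp env p) (pval inp env q).
Proof. destruct d; simpl; ring. Qed.

Lemma sat_legs_system inp env ds : forall k,
  sat inp env (legs_system k ds) <-> legs env k ds.
Proof.
  induction ds as [|d ds IH]; intros k; cbn [legs_system legs].
  - rewrite !sat_cons, sat_nil; unfold time_left; simpl; split; [lra|].
    intros H; repeat split; lra.
  - unfold leg_system, leg; rewrite !sat_app, IH, !sat_cons, sat_nil, !sat_l1_system, !lval_lgap.
    replace (lval inp env (LSub (vtime k) (vtime (S k))))
      with (time_left env k - time_left env (S k)) by (simpl; unfold time_left; simpl; ring).
    unfold pval, vrobot1, vrobot2, robot1, robot2; cbn [fst snd lval]; tauto.
Qed.

Lemma sat_htrap_system inp env j p :
  ty0 (htrap_at inp j) < ty1 (htrap_at inp j) ->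
  sat inp env (htrap_system j p) <-> in_htrap (htrap_at inp j) (pval inp env p).
Proof.
  unfold htrap_system, in_htrap, htrap_at; rewrite !sat_cons, sat_nil; simpl.
  set (a := nth (j + 0) inp 0); set (b := nth (j + 1) inp 0).
  set (l := nth (j + 2) inp 0); set (r := nth (j + 3) inp 0).
  set (l' := nth (j + 4) inp 0); set (r' := nth (j + 5) inp 0).
  set (x := lval inp env (fst p)); set (y := lval inp env (snd p)).
  intros Hab.
  assert (Hl : (y - a) / (b - a) * (l' - l) * (b - a) = (y - a) * (l' - l)) by (field; lra).
  assert (Hr : (y - a) / (b - a) * (r' - r) * (b - a) = (y - a) * (r' - r)) by (field; lra).
  set (u := (y - a) / (b - a) * (l' - l)) in *.
  set (w := (y - a) / (b - a) * (r' - r)) in *.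
  split.
  - intros (H1 & H2 & H3 & H4 & _); split; [lra|].
    split; apply Rmult_le_reg_r with (b - a); lra.
  - intros ((H1 & H2) & (H3 & H4)).
    apply Rmult_le_compat_r with (r := b - a) in H3; [|lra].
    apply Rmult_le_compat_r with (r := b - a) in H4; [|lra].
    repeat split; lra.
Qed.

Lemma sat_sigma_system inp env i s p q :
  nth i inp 0 = IZR s -> (-2 <= s <= 2)%Z ->
  sat inp env (sigma_system (AInp i) p q) <->
  sigma_cond s (pval inp env p) (pval inp env q).
Proof.
  intros Hi Hs; unfold sigma_system, sigma_cond.
  rewrite !sat_cons, sat_nil; simpl; rewrite Hi.
  assert (s = -2 \/ s = -1 \/ s = 0 \/ s = 1 \/ s = 2)%Z as H by lia.
  destruct H as [->|[->|[->|[->| ->]]]]; split; intros H;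
    repeat split; intros; try discriminate; try lra;
    destruct H as (H1 & H2 & H3 & H4);
    first [specialize (H1 eq_refl)|specialize (H2 eq_refl)|specialize (H3 eq_refl)
          |specialize (H4 eq_refl)|idtac]; lra.
Qed.

Lemma sat_state_system inp env j k X Y s :
  htrap_at inp j = X -> htrap_at inp (j + 6) = Y -> nth (j + 12) inp 0 = IZR s ->
  valid_state X Y s ->
  sat inp env (state_system j k) <->
  in_htrap X (robot1 env k) /\ in_htrap Y (robot2 env k) /\
  sigma_cond s (robot1 env k) (robot2 env k).
Proof.
  intros HX HY Hs (WX & WY & _ & Bs); unfold state_system.
  rewrite !sat_app, (sat_sigma_system _ _ _ s), !sat_htrap_system, HX, HY by
    (try rewrite HX; try rewrite HY; first [apply WX|apply WY|assumption]).
  reflexivity.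
Qed.

Lemma sat_schedule_system env ds X Y s X' Y' s' :
  valid_state X Y s -> valid_state X' Y' s' ->
  let n := length ds in
  sat (enc_states X Y s X' Y' s') env (schedule_system ds) <->
  legs env 0 ds /\
  (in_htrap X (robot1 env 0) /\ in_htrap Y (robot2 env 0) /\
   sigma_cond s (robot1 env 0) (robot2 env 0)) /\
  (in_htrap X' (robot1 env n) /\ in_htrap Y' (robot2 env n) /\
   sigma_cond s' (robot1 env n) (robot2 env n)).
Proof.
  intros V V' n; unfold schedule_system.
  rewrite !sat_app, sat_legs_system, (sat_state_system _ _ 0 0 X Y s),
    (sat_state_system _ _ 13 _ X' Y' s') by
    (try assumption; try reflexivity; destruct X, Y, X', Y'; reflexivity).
  tauto.
Qed.

(** * Reduction to finitely many sequences of half-planes *)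

Fixpoint words (n : nat) : list (list dir) :=
  match n with
  | 0%nat => nil
  | S n => flat_map (fun d => [d] :: map (cons d) (words n)) dirs
  end.

Lemma In_words n : forall ds, (length ds <= n)%nat -> ds <> nil -> In ds (words n).
Proof.
  induction n as [|n IH]; intros [|d ds] H Hn; simpl in H; try lia; try contradiction.
  apply in_flat_map; exists d; split; [destruct d; simpl; tauto|].
  destruct ds as [|d' ds]; [left; reflexivity|right].
  apply in_map, IH; [lia|discriminate].
Qed.

Lemma words_nonempty n ds : In ds (words n) -> ds <> nil.
Proof.
  destruct n; [intros []|]; intros H; apply in_flat_map in H.
  destruct H as [d [_ [<-|H]]]; [discriminate|].
  apply in_map_iff in H; destruct H as [u [<- _]]; discriminate.
Qed.

(** Straightening keeps the makespan, so the two sets of makespans coincide and not only their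
    minima. Existence of an optimal schedule then comes from the linear systems. The bound 4 is the
    number of half-planes. *)
Lemma schedule_makespan_iff X Y s X' Y' s' v :
  valid_state X Y s -> valid_state X' Y' s' ->
  (exists t0 t1 m1 m2, schedule_between X Y s X' Y' s' t0 t1 m1 m2 /\ t1 - t0 = v) <->
  (exists ds, In ds (words 4) /\ 0 <= v /\
     exists env, env 0%nat = v /\ sat (enc_states X Y s X' Y' s') env (schedule_system ds)).
Proof.
  intros V V'; split.
  - intros (t0 & t1 & m1 & m2 & (((Ht & L1 & _) & (_ & L2 & _) & Hfree) & (_ & S0) & (_ & S1)) & E).
    destruct (schedule_to_legs m1 m2 t1 4 dirs t0 (le_n 4) Ht L1 L2)
      as (ds & env & Hne & Hlen & HL & HT & A0 & B0 & A1 & B1).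
    { intros t Htt; apply in_F2_gap, Hfree, Htt. }
    exists ds; split; [apply In_words; assumption|]; split; [lra|].
    exists env; split; [rewrite <- E; exact HT|].
    apply sat_schedule_system; [assumption..|].
    rewrite A0, B0, A1, B1; auto.
  - intros (ds & Hds & Hv & env & E & Hs).
    apply sat_schedule_system in Hs; [|assumption..].
    destruct Hs as (HL & S0 & S1).
    assert (HF := legs_end_in_F2 env ds 0 (words_nonempty 4 ds Hds) HL).
    destruct (legs_to_schedule env ds 0 0 HL HF)
      as (m1 & m2 & c1 & c2 & F1 & F2 & Hfree & A0 & B0 & A1 & B1).
    change (time_left env 0) with (env 0%nat) in *.
    rewrite E, Rplus_0_l in *; cbn [Nat.add] in *.
    exists 0, v, m1, m2; split; [|ring].
    unfold schedule_between, feasible_schedule, trajectory, in_state.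
    rewrite A0, B0, A1, B1.
    destruct F1 as (_ & L1 & I1), F2 as (_ & L2 & I2).
    repeat split; try assumption; try (apply S0 || apply S1); try lra.
    + exists (robot1 env 0 :: c1); split; [discriminate|exact I1].
    + exists (robot2 env 0 :: c2); split; [discriminate|exact I2].
    + rewrite <- A0, <- B0; apply Hfree; lra.
Qed.

Theorem theorem3p7 :
  exists T : ctree,
    forall (X Y : htrap) (s : Z) (X' Y' : htrap) (s' : Z),
      valid_state X Y s -> valid_state X' Y' s' ->
      min_makespan_answer X Y s X' Y' s' (ceval (enc_states X Y s X' Y' s') T).
Proof.
  (* The tree is built from the words alone, before any state is given. *)
  destruct (min_computable_ex_In (list dir) (words 4) _
    (fun ds => linear_system_min_computable (schedule_system ds))) as [T HT].
  exists T; intros X Y s X' Y' s' V V'.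
  specialize (HT (enc_states X Y s X' Y' s')).
  assert (Hiff := fun v => schedule_makespan_iff X Y s X' Y' s' v V V').
  destruct (ceval (enc_states X Y s X' Y' s') T) as [v|]; simpl.
  - destruct HT as [Hex Hmin]; split; [apply Hiff, Hex|].
    intros t0 t1 m1 m2 H; apply Hmin, Hiff; eauto 6.
  - intros t0 t1 m1 m2 H; apply (HT (t1 - t0)), Hiff; eauto 6.
Qed.
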